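(* Let $F(X)\in\mathbb{Z}[X]$ be a nice polynomial (with the standing assumptions below), let $G(x)=x$, and let $k$ be a positive integer. Then: (1) The set $\mathscr{B}_{F,G,k}$ has positive lower density if and only if $\mathscr{B}_{F,G,k}\neq\emptyset$. (2) If moreover $F$ is nicer, then the set $\mathscr{A}_{F,G,k}$ has positive lower density if and only if $\mathscr{A}_{F,G,k}\neq\emptyset$.
   Context: Standing assumptions: $F(X)\in\mathbb{Z}[X]$ has positive leading coefficient and degree $d\ge 2$. Define $a_0=0$ and $a_n=F(a_{n-1})$ for $n\ge1$; it is assumed that $0$ is a wandering point, i.e. the sequence $(a_n)$ is unbounded (takes infinitely many values). For $G\in\mathbb{Z}[x]$ and a positive integer $k$, $\mathscr{B}_{F,G,k}$ is the set of positive integers $n$ such that $k\mid\gcd(G(n),a_n)$ and every prime $p$ dividing $\gcd(G(n),a_n)$ divides $k$; and $\mathscr{A}_{F,G,k}=\{n\ge1:\gcd(G(n),a_n)=k\}\subseteq\mathscr{B}_{F,G,k}$. The polynomial $F$ is called nice if $\sum_{p \text{ prime},\, p\mid a_p}\frac1p<\infty$, and nicer if it is nice and its coefficient of $X^1$ is zero. The lower density of a set $\mathcal S$ of positive integers is $\liminf_{x\to\infty}\#(\mathcal S\cap[1,x])/x$. *)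

(* Defs.v *)
From HB Require Import structures.
From mathcomp Require Import all_boot all_order all_algebra.
From mathcomp Require Import finmap.
From mathcomp Require Import all_classical all_reals all_analysis.
Set Implicit Arguments.
Unset Strict Implicit.
Unset Printing Implicit Defensive.
Import Order.TTheory GRing.Theory Num.Theory.
Import numFieldNormedType.Exports.
Local Open Scope classical_set_scope.
Local Open Scope ring_scope.

Definition orbit0 (F : {poly int}) (n : nat) : int :=
  iter n (fun x : int => F.[x]) 0.

Definition wandering0 (F : {poly int}) : Prop :=
  infinite_set (range (orbit0 F)).

Definition gcd_orbit (F G : {poly int}) (n : nat) : int :=
  gcdz G.[n%:Z] (orbit0 F n).

Definition B_set (F G : {poly int}) (k : nat) : set nat :=
  [set n | [/\ (1 <= n)%N,
               (k%:Z %| gcd_orbit F G n)%Z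
             & forall p : nat, prime p ->
                 (p%:Z %| gcd_orbit F G n)%Z -> (p %| k)%N]].

Definition A_set (F G : {poly int}) (k : nat) : set nat :=
  [set n | (1 <= n)%N /\ gcd_orbit F G n = k%:Z].

Definition nice (R : realType) (F : {poly int}) : Prop :=
  (\sum_(0 <= p <oo | prime p && (p%:Z %| orbit0 F p)%Z)
     ((p%:R : R)^-1)%:E < +oo)%E.

Definition nicer (R : realType) (F : {poly int}) : Prop :=
  nice R F /\ F`_1 = 0.

(* #(S `&` [1, x]); the set is finite, so [fset_set] is not the junk value *)
Definition counting_upto (R : realType) (S : set nat) (x : R) : nat :=
  #|` fset_set (S `&` [set n : nat | (1 <= n)%N /\ n%:R <= x]) |%fset.

Definition lower_density (R : realType) (S : set nat) : \bar R :=
  limf_einf (fun x : R => ((counting_upto S x)%:R / x)%:E) (pinfty_nbhs R).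

(* Main.v *)
(* Write c_n = |a_n|.  For each m the set {n : m | c_n} consists of the multiples
   of some z(m) (with z(m) = 0 if it is {0}), so m | gcd(n, c_n) iff
   l(m) = lcm(m, z(m)) divides n.  Hence a member n0 of either set stays in it after
   multiplication by any factor for which the product avoids the multiples of the
   numbers l(p), p not dividing k (resp. l(pk), p prime), and it suffices that the
   reciprocals of these numbers are summable.

   Pigeonhole gives z(p) <= p, so either p | a_p, which niceness handles, or
   l(p) = p z(p).  As c_n <= 2^(2^(sn)), few primes p in (2^j, 2^(j+1)] satisfy
   z(p) <= j/(2s), and for the others 1/(p z(p)) = O(2^-j / j), while Chebyshev's
   argument bounds the number of primes in the block by 2^(j+1)/j.  Thus the block
   contributes O(1/j^2).

   Finally, if n0 is a multiple of no b_i and the sum of 1/b_i converges, let Q be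
   the product of the b_i with i < N.  No n0 (tQ + 1) is a multiple of these b_i,
   and at most T n0 / b_i + 1 indices t < T make it a multiple of a given b_i; for
   N large this leaves a positive proportion of the t. *)
Require Import Defs.
From HB Require Import structures.
From mathcomp Require Import all_boot all_order all_algebra.
From mathcomp Require Import finmap.
From mathcomp Require Import all_classical all_reals all_analysis.
From mathcomp Require Import zify ring lra.
Import Order.TTheory GRing.Theory Num.Theory.
Import numFieldNormedType.Exports.
Local Open Scope classical_set_scope.
Local Open Scope ring_scope.
Set Implicit Arguments.
Unset Strict Implicit.
Unset Printing Implicit Defensive.

(** * Sets of multiples, and Chebyshev-type counts of primes *)

(** The least positive element serves as [l], since [P] only sees the remainder modulo it; if there
    is none, [l = 0], whose only multiple is 0. *)
Lemma periodic_pred_dvdn (P : pred nat) :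
  P 0%N -> (forall z n, P z -> P (z + n)%N = P n) ->
  exists l, forall n, P n = (l %| n)%N.
Proof.
move=> P0 PD; case: (pselect (exists n, (0 < n)%N && P n)) => [exP|noP].
  case: (ex_minnP exP) => l /andP[l_gt0 Pl] minl; exists l => n.
  have Pmul q r : P (q * l + r)%N = P r.
    by elim: q => [|q IHq] //; rewrite mulSn -addnA PD.
  rewrite {1}(divn_eq n l) Pmul /dvdn; case: posnP => [->|r_gt0]; first exact: P0.
  apply/negP => Pr; have := minl (n %% l)%N; rewrite r_gt0 Pr => /(_ isT).
  by rewrite leqNgt ltn_pmod.
exists 0%N => n; rewrite dvd0n; case: posnP => [->|n_gt0]; first exact: P0.
by apply/negP => Pn; apply: noP; exists n; rewrite n_gt0.
Qed.

Lemma prod_primes_dvdn (s : seq nat) (n : nat) :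
  uniq s -> all (fun p => prime p && (p %| n)%N) s -> (\prod_(p <- s) p %| n)%N.
Proof.
elim: s => [|p s IHs] /=; first by rewrite big_nil dvd1n.
move=> /andP[ps us] /andP[/andP[pp pn] alls].
rewrite big_cons Gauss_dvd ?pn ?IHs //.
rewrite prime_coprime //; apply/negP => /[!big_seq].
elim/big_ind: _ => [|x y IHx IHy|q qs].
- by rewrite Euclid_dvd1.
- by rewrite Euclid_dvdM // => /orP[].
- have /andP[pq _] := allP alls _ qs; rewrite dvdn_prime2 // => /eqP e.
  by rewrite e qs in ps.
Qed.

(** The product of distinct prime divisors divides [n]. Both prime counts below come from this, one
    with a binomial coefficient as [n], the other with a product of orbit terms. *)
Lemma expn_size_primes_leq (s : seq nat) (m n : nat) :
  (0 < n)%N -> uniq s ->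
  all (fun p => [&& prime p, (p %| n)%N & (m <= p)%N]) s ->
  (m ^ size s <= n)%N.
Proof.
move=> n_gt0 us alls; apply: (@leq_trans (\prod_(p <- s) p)).
  elim: s {us} alls => [|p s IHs] /=; first by rewrite big_nil.
  by move=> /andP[/and3P[_ _ mp] /IHs le_s]; rewrite big_cons expnS leq_mul.
apply: dvdn_leq => //; apply: prod_primes_dvdn => //.
by apply: sub_all alls => p /and3P[-> ->].
Qed.

Lemma prime_dvdn_fact_leq (p n : nat) : prime p -> (p %| n`!)%N -> (p <= n)%N.
Proof.
move=> pp; elim: n => [|n IHn]; first by rewrite Euclid_dvd1.
by rewrite factS Euclid_dvdM // => /orP[/dvdn_leq -> //|/IHn/leqW].
Qed.

Lemma prime_dvdn_central_bin (n p : nat) :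
  prime p -> (n < p <= n.*2)%N -> (p %| 'C(n.*2, n))%N.
Proof.
move=> pp /andP[np pn].
have : (p %| (n.*2)`!)%N by apply: dvdn_fact; rewrite prime_gt0.
have le_n : (n <= n.*2)%N by rewrite -addnn leq_addr.
rewrite -(bin_fact le_n) !Euclid_dvdM // -{2}addnn addnK orbb => /orP[//|].
by move/(prime_dvdn_fact_leq pp); rewrite leqNgt np.
Qed.

Lemma central_bin_leq (n : nat) : ('C(n.*2, n) <= 2 ^ n.*2)%N.
Proof.
rewrite -[2%N]/((1 + 1)%N) expnDn.
have ltn2 : (n < n.*2.+1)%N by rewrite ltnS -addnn leq_addr.
rewrite (bigD1 (Ordinal ltn2)) //= !exp1n !muln1; exact: leq_addr.
Qed.

Section PrimeBlock.
Local Open Scope nat_scope.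

(** Chebyshev's argument: these primes exceed [2 ^ j] and all divide the central binomial
    coefficient of order [2 ^ j], which is at most [2 ^ 2 ^ j.+1]. *)
Lemma size_prime_block (j : nat) (s : seq nat) :
  uniq s -> all (fun p => prime p && (2 ^ j < p <= 2 ^ j.+1)) s ->
  j * size s <= 2 ^ j.+1.
Proof.
move=> us alls; rewrite -(leq_exp2l (m := 2)) // expnM.
apply: (@leq_trans 'C((2 ^ j).*2, 2 ^ j)).
  apply: expn_size_primes_leq => //; first by rewrite bin_gt0 -addnn leq_addr.
  apply: sub_all alls => p /andP[pp /andP[lp up]].
  rewrite pp (ltnW lp) prime_dvdn_central_bin //= lp /=.
  by rewrite -muln2 -expnSr.
by rewrite expnS mul2n; apply: central_bin_leq.
Qed.

Lemma size_prime_block_small_rank (c : nat -> nat) (s j : nat) (z : nat -> nat)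
    (t : seq nat) :
  0 < s -> (forall n, 0 < n -> 0 < c n <= 2 ^ 2 ^ (s * n)) -> uniq t ->
  all (fun p => [&& prime p, 2 ^ j < p, 0 < z p, p %| c (z p) &
                    (s * z p).*2 <= j]) t ->
  j * size t <= j * 2 ^ j./2.
Proof.
move=> s_gt0 cP ut allt; rewrite -(leq_exp2l (m := 2)) // expnM.
(* The ranks in question are at most [m], so every such prime divides [c 1 * ... * c m], a product
   of [m <= j] factors each at most [2 ^ 2 ^ j./2]. *)
set m := (j./2 %/ s).
have srm r : (r < m.+1) = (s * r <= j./2) by rewrite ltnS leq_divRL // mulnC.
apply: (@leq_trans (\prod_(1 <= r < m.+1) c r)).
  apply: expn_size_primes_leq => //.
    rewrite big_seq prodn_cond_gt0 // => r; rewrite mem_index_iota => /andP[r0 _].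
    by have /andP[] := cP _ r0.
  apply: sub_all allt => p /and5P[-> lp zp dvp szp]; rewrite (ltnW lp) andbT /=.
  apply: dvdn_trans dvp _.
  have zr : z p \in index_iota 1 m.+1.
    by rewrite mem_index_iota zp srm -(doubleK (s * z p)) half_leq.
  by rewrite (bigD1_seq (z p)) ?iota_uniq //= dvdn_mulr.
apply: (@leq_trans (\prod_(1 <= r < m.+1) 2 ^ 2 ^ j./2)).
  rewrite !big_nat; apply: leq_prod => r /andP[r0 rm].
  have /andP[_ /leq_trans] := cP _ r0; apply.
  by rewrite !leq_exp2l // -srm.
rewrite prod_nat_const_nat -expnM leq_exp2l // mulnC leq_mul2r subn1 /=.
apply/orP; right; apply: leq_trans (leq_div _ _) _; lia.
Qed.
End PrimeBlock.

(** * The orbit of 0: ranks of apparition, nonvanishing and growth *)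

Lemma orbit0S (F : {poly int}) (n : nat) : orbit0 F n.+1 = F.[orbit0 F n].
Proof. by []. Qed.

Lemma horner_dvdz_sub (F : {poly int}) (m x y : int) :
  (m %| x - y)%Z -> (m %| F.[x] - F.[y])%Z.
Proof.
move=> mxy; elim/poly_ind: F => [|F c IHF]; first by rewrite !horner0 subrr dvdz0.
rewrite !hornerMXaddC.
have -> : F.[x] * x + c - (F.[y] * y + c) = F.[x] * (x - y) + (F.[x] - F.[y]) * y.
  by ring.
by apply: rpredD; [apply: dvdz_mull | apply: dvdz_mulr].
Qed.

Lemma orbit0_dvdz_sub (F : {poly int}) (m : int) (i j n : nat) :
  (m %| orbit0 F i - orbit0 F j)%Z -> (m %| orbit0 F (n + i) - orbit0 F (n + j))%Z.
Proof. by move=> mij; elim: n => [|n IHn] //; rewrite !addSn; apply: horner_dvdz_sub. Qed.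

Lemma dvdz_sub_eq (m x y : int) : (m %| x - y)%Z -> (m %| x)%Z = (m %| y)%Z.
Proof. by move=> mxy; rewrite -{1}(subrK y x); apply: rpredDl. Qed.

(** Modulo [m] the orbit is back at its starting value 0 at time [z], so it repeats from there. *)
Lemma orbit0_dvdz_shift (F : {poly int}) (m : int) (z n : nat) :
  (m %| orbit0 F z)%Z -> (m %| orbit0 F (z + n))%Z = (m %| orbit0 F n)%Z.
Proof.
move=> mz; rewrite addnC -{2}(addn0 n); apply: dvdz_sub_eq.
by apply: orbit0_dvdz_sub; rewrite subr0.
Qed.

Lemma orbit0_rank (F : {poly int}) :
  exists z : nat -> nat, forall m n, (m %| `|orbit0 F n|)%N = (z m %| n)%N.
Proof.
have /choice[z zP] m : exists l, forall n, (m %| `|orbit0 F n|)%N = (l %| n)%N.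
  apply: periodic_pred_dvdn => [|x n /= mx]; first exact: dvdn0.
  by have := @orbit0_dvdz_shift F m%:Z x n; rewrite !dvdzE => /(_ mx).
by exists z.
Qed.

(* Pigeonhole on the residues of the orbit modulo [m]. *)
Lemma orbit0_rank_leq (F : {poly int}) (z : nat -> nat) (m : nat) :
  (forall m n, (m %| `|orbit0 F n|)%N = (z m %| n)%N) -> (0 < m)%N -> (z m <= m)%N.
Proof.
move=> zP m_gt0; rewrite leqNgt; apply/negP => lt_mz.
pose f (i : 'I_(z m)) : 'I_m := Ordinal (ltn_pmod `|(orbit0 F i %% m)%Z| m_gt0).
have /injectivePn[i [j neq_ij fij]] : ~~ injectiveb f.
  apply/negP => /injectiveP /leq_card; rewrite !card_ord leqNgt lt_mz //.
wlog lt_ij : i j neq_ij fij / (i < j)%N.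
  move=> W; case: (ltngtP i j) => [|lt_ji|/val_inj eq_ij]; first exact: W.
    by apply: (W j i) => //; rewrite eq_sym.
  by rewrite eq_ij eqxx in neq_ij.
have : (m %| orbit0 F i - orbit0 F j)%Z.
  have ge0 k : 0 <= (orbit0 F k %% m)%Z by apply: modz_ge0; lia.
  have ltm k : (`|(orbit0 F k %% m)%Z| < m)%N.
    have := @ltz_pmod (orbit0 F k) m; lia.
  have /(congr1 val) /= := fij; rewrite !modn_small // => eq_abs.
  rewrite -eqz_mod_dvd; apply/eqP.
  by rewrite -(gez0_abs (ge0 i)) -(gez0_abs (ge0 j)) eq_abs.
(* Running both terms forward by [z m - j] turns the second into [orbit0 F (z m)], which is 0 modulo
   [m]. So [z m] would divide [z m - j + i], which lies strictly between 0 and [z m]. *)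
move=> /(@orbit0_dvdz_sub _ _ _ _ (z m - j)).
rewrite subnK; last by apply: ltnW.
have dz : (m %| orbit0 F (z m))%Z by rewrite dvdzE /= zP.
move/dvdz_sub_eq; rewrite dz dvdzE /= zP => /dvdn_leq.
by have := ltn_ord j; lia.
Qed.

(** A return to 0 would make the orbit periodic, hence finite. *)
Lemma orbit0_neq0 (F : {poly int}) (n : nat) :
  wandering0 F -> (0 < n)%N -> orbit0 F n != 0.
Proof.
move=> wF n_gt0; apply/eqP => an0; apply: wF.
apply: (@sub_finite_set _ _ (orbit0 F @` `I_n)); last exact/finite_image/finite_II.
move=> _ [k _ <-]; exists (k %% n)%N; first by rewrite /= ltn_pmod.
have shift q r : orbit0 F (q * n + r) = orbit0 F r.
  elim: q => [|q IHq] //; rewrite mulSn -addnA addnC /orbit0 iterD -/(orbit0 F n) an0.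
  exact: IHq.
by rewrite [in RHS](divn_eq k n) shift.
Qed.

(** Bounding exponents makes the estimate iterate: each step of the orbit multiplies the exponent by
    at most [2 ^ s], which gives doubly exponential growth. *)
Lemma horner_int_growth (F : {poly int}) :
  exists2 s : nat, (0 < s)%N &
    forall x e, (0 < e)%N -> (`|x| <= 2 ^ e)%N -> (`|F.[x]| <= 2 ^ (2 ^ s * e))%N.
Proof.
pose M := (\sum_(i < size F) `|(F`_i)%R|)%N.
exists (M + size F).+1 => // x e e_gt0 xe.
have Fx : (`|F.[x]| <= M * 2 ^ (e * size F))%N.
  rewrite horner_coef big_distrl /=.
  elim/big_ind2: _ => [|a b c d ab cd|i _] //.
    by lia.
  rewrite abszM leq_mul // abszX.
  apply: leq_trans (_ : (2 ^ e) ^ i <= _)%N; first by case: (val i) => // k; rewrite leq_exp2r.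
  by rewrite -expnM leq_exp2l // leq_mul2l ltnW ?orbT.
apply: leq_trans Fx _; apply: (@leq_trans (2 ^ M * 2 ^ (e * size F))).
  by rewrite leq_mul2r (ltnW (ltn_expl _ _)) ?orbT.
rewrite -expnD leq_exp2l //; apply: (@leq_trans ((M + size F) * e)); first by nia.
rewrite leq_mul2r; apply/orP; right; apply: ltnW.
by apply: leq_trans (ltn_expl _ (leqnn 2)) _; rewrite leq_exp2l.
Qed.

Lemma orbit0_growth (F : {poly int}) :
  exists2 s : nat, (0 < s)%N & forall n, (`|orbit0 F n| <= 2 ^ 2 ^ (s * n))%N.
Proof.
have [s s_gt0 Fs] := horner_int_growth F; exists s => //.
elim=> [|n IHn] //; rewrite orbit0S.
by rewrite mulnS expnD; apply: Fs => //; rewrite expn_gt0.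
Qed.

(** * Summing reciprocals over primes, block by dyadic block *)

Lemma nice_sum_bounded (R : realType) (F : {poly int}) : nice R F ->
  exists M : R, forall N : nat,
    \sum_(0 <= p < N | prime p && (p %| `|orbit0 F p|)%N) (p%:R)^-1 <= M.
Proof.
rewrite /nice => nF.
have ge0 n : (0 <= n)%N -> prime n && (n%:Z %| orbit0 F n)%Z ->
    (0%:E <= ((n%:R : R)^-1)%:E)%E by rewrite lee_fin invr_ge0.
pose S := (\sum_(0 <= p <oo | prime p && (p%:Z %| orbit0 F p)%Z)
     ((p%:R : R)^-1)%:E)%E.
exists (fine S) => N.
have := nneseries_lim_ge N ge0; rewrite sumEFin -/S.
move: nF; rewrite -/S; by case: S.
Qed.

Lemma sum_leq_size (R : realType) (I : eqType) (r : seq I) (P : pred I)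
    (f : I -> R) (C : R) :
  (forall i, i \in r -> P i -> f i <= C) ->
  \sum_(i <- r | P i) f i <= C * (size [seq i <- r | P i])%:R.
Proof.
move=> fC; rewrite -big_filter.
have: forall i, i \in [seq i <- r | P i] -> f i <= C.
  by move=> i; rewrite mem_filter => /andP[Pi ir]; exact: fC.
elim: [seq i <- r | P i] => [|i s IHs] fs; first by rewrite big_nil mulr0.
rewrite big_cons /= -natr1 mulrDr mulr1 addrC lerD ?fs ?mem_head //.
by apply: IHs => k ks; rewrite fs // inE ks orbT.
Qed.

Lemma sqr_leq_exp2 (i : nat) : (i ^ 2 <= 2 * 2 ^ i)%N.
Proof.
elim: i => // -[|[|[|i]]] // IHi; rewrite [(2 ^ i.+4)%N]expnS.
by apply: leq_trans (leq_mul (leqnn 2) IHi); rewrite -!mulnn; nia.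
Qed.

Lemma sqr_exp2_half_leq (j : nat) : (j ^ 2 * 2 ^ j./2 <= 8 * 2 ^ j)%N.
Proof.
have jE : j = (odd j + 2 * j./2)%N by rewrite mul2n odd_double_half.
have h1 := sqr_leq_exp2 j./2; have h2 := sqr_leq_exp2 j./2.+1.
(* With [i = j./2], even [j] uses the square bound at [i], and odd [j] uses it at [i + 1] because
   [2 * i + 1 <= 2 * (i + 1)]. *)
have : (j ^ 2 <= 8 * 2 ^ odd j * 2 ^ j./2)%N.
  move: j./2 (odd j) jE h1 h2 => i b ->.
  rewrite [(2 ^ i.+1)%N]expnS -!mulnn; move: (2 ^ i)%N => x.
  by case: b; rewrite ?expn1 ?expn0; nia.
move=> le_j; apply: leq_trans (leq_mul le_j (leqnn _)) _.
by rewrite -!mulnA -!expnD addnn -mul2n -jE.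
Qed.

Lemma prime_block_sum (R : realType) (c z : nat -> nat) (s j : nat) :
  (0 < s)%N -> (forall n, (0 < n)%N -> (0 < c n <= 2 ^ 2 ^ (s * n))%N) ->
  (forall p, (p %| c (z p))%N) -> (0 < j)%N ->
  \sum_((2 ^ j).+1 <= p < (2 ^ j.+1).+1 | prime p && (0 < z p)%N)
      ((p * z p)%:R : R)^-1 <= (4 * s + 8)%:R / j%:R ^+ 2.
Proof.
move=> s_gt0 cP zP j_gt0.
have j0 : 0 < j%:R :> R by rewrite ltr0n.
have p0 : 0 < 2 ^+ j :> R by rewrite exprn_gt0.
(* Large ranks give at most [2 ^ j.+1 / j] terms of size at most [2 * s / (2 ^ j * j)], whence
   [4 * s]. Small ranks give at most [2 ^ j./2] terms of size at most [2 ^- j], whence [8]. *)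
rewrite (bigID (fun p => (s * z p).*2 <= j)%N) /= natrD mulrDl addrC lerD //.
  apply: le_trans (sum_leq_size (C := (2 * s)%:R / (2 ^+ j * j%:R)) _) _.
    move=> p; rewrite mem_index_iota => /andP[lp _] /andP[/andP[pp zp]].
    rewrite -ltnNge => jz.
    rewrite ler_pdivlMr ?mulr_gt0 // mulrC ler_pdivrMr ?ltr0n ?muln_gt0 ?(prime_gt0 pp) ?zp //.
    by rewrite -natrX -!natrM ler_nat; nia.
  set t := seq.filter _ _.
  have : (j * size t <= 2 ^ j.+1)%N.
    apply: size_prime_block; first by rewrite filter_uniq ?iota_uniq.
    apply/allP => p; rewrite mem_filter mem_index_iota ltnS.
    by move=> /andP[/andP[/andP[-> _] _] ->].
  rewrite -(ler_nat R) natrM natrX exprS => H.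
  rewrite ler_pdivlMr ?exprn_gt0 //.
  have -> : (2 * s)%:R / (2 ^+ j * j%:R) * (size t)%:R * j%:R ^+ 2 =
            (2 * s)%:R * (j%:R * (size t)%:R) / 2 ^+ j :> R.
    by field; rewrite !lt0r_neq0.
  rewrite ler_pdivrMr // (_ : (4 * s)%:R * _ = (2 * s)%:R * (2 * 2 ^+ j)).
    by rewrite ler_wpM2l.
  by rewrite !natrM; ring.
apply: le_trans (sum_leq_size (C := (2 ^+ j)^-1) _) _.
  move=> p; rewrite mem_index_iota => /andP[lp _] /andP[/andP[pp zp] _].
  rewrite lef_pV2 ?posrE // ?ltr0n ?muln_gt0 ?(prime_gt0 pp) ?zp //.
  by rewrite -natrX ler_nat; nia.
set t := seq.filter _ _.
have : (j * size t <= j * 2 ^ j./2)%N.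
  apply: (size_prime_block_small_rank (z := z) s_gt0 cP).
    by rewrite filter_uniq ?iota_uniq.
  apply/allP => p; rewrite mem_filter mem_index_iota zP.
  by move=> /andP[/andP[/andP[-> ->] ->] /andP[-> _]].
rewrite leq_pmul2l // => H.
rewrite ler_pdivlMr ?exprn_gt0 // -mulrA mulrC ler_pdivrMr //.
rewrite -!natrX -!natrM ler_nat mulnC.
apply: leq_trans (sqr_exp2_half_leq j); rewrite leq_mul2l H orbT //.
Qed.

Lemma sum_prime_rank_bounded (R : realType) (c z : nat -> nat) (s : nat) :
  (0 < s)%N -> (forall n, (0 < n)%N -> (0 < c n <= 2 ^ 2 ^ (s * n))%N) ->
  (forall p, (p %| c (z p))%N) ->
  exists M : R, forall N : nat,
    \sum_(0 <= p < N | prime p && (0 < z p)%N) ((p * z p)%:R : R)^-1 <= M.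
Proof.
move=> s_gt0 cP zP; pose C : R := (4 * s + 8)%:R.
pose f p := ((p * z p)%:R : R)^-1.
have f0 p : 0 <= f p by rewrite invr_ge0.
have C0 : 0 <= C by [].
(* The blocks with [j >= 1] start at 3. The right side telescopes:
   [1 / x ^ 2 <= 2 * (1 / x - 1 / (x + 1))] for [x >= 1]. *)
have dyadic J : \sum_(3 <= p < (2 ^ J.+1).+1 | prime p && (0 < z p)%N) f p
    <= 2 * C * (1 - J.+1%:R^-1).
  elim: J => [|J IHJ]; first by rewrite big_geq // invr1 subrr mulr0.
  rewrite (big_cat_nat (n := (2 ^ J.+1).+1)) /=; last 2 first.
  - by rewrite ltnS (@leq_exp2l 2 1).
  - by rewrite ltnS leq_exp2l.
  apply: le_trans (lerD IHJ (prime_block_sum R s_gt0 cP zP (ltn0Sn J))) _.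
  rewrite -/C -[J.+2%:R]natr1.
  have : 1 <= J.+1%:R :> R by rewrite ler1n.
  move: (J.+1%:R) => x x1.
  rewrite -subr_ge0.
  have -> : 2 * C * (1 - (x + 1)^-1) - (2 * C * (1 - x^-1) + C / x ^+ 2) =
    C * (x - 1) / (x ^+ 2 * (x + 1)).
    by field; rewrite ?lt0r_neq0 //; lra.
  by rewrite divr_ge0 ?mulr_ge0 ?exprn_ge0 //; lra.
exists (\sum_(0 <= p < 3 | prime p && (0 < z p)%N) f p + 2 * C) => N.
have le_N : (N <= (2 ^ N.+1).+1)%N.
  by apply: leq_trans (ltnW (ltn_expl N (leqnn 2))) _; rewrite ltnW // ltnS leq_exp2l.
have le_3 : (3 <= (2 ^ N.+1).+1)%N by rewrite ltnS (@leq_exp2l 2 1).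
apply: (@le_trans _ _ (\sum_(0 <= p < (2 ^ N.+1).+1 | prime p && (0 < z p)%N) f p)).
  by rewrite [leRHS](big_cat_nat (n := N)) //= lerDl sumr_ge0.
rewrite (big_cat_nat (n := 3)) //= lerD //.
by apply: le_trans (dyadic N) _; rewrite ler_piMr ?mulr_ge0.
Qed.

(** * Sieving out multiples, and lower density *)

Lemma bounded_sum_tail (R : realType) (u : nat -> R) (M e : R) :
  (forall i, 0 <= u i) -> (forall N, \sum_(0 <= i < N) u i <= M) -> 0 < e ->
  exists N, forall m n, (N <= m)%N -> \sum_(m <= i < n) u i <= e.
Proof.
move=> u0 uM e0; pose E := range (fun N => \sum_(0 <= i < N) u i).
have supE : has_sup E.
  by split; [exists (\sum_(0 <= i < 0) u i), 0%N | exists M => _ [N _ <-]].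
have [_ [N _ <-] ltN] := sup_adherent e0 supE.
exists N => m n le_Nm; have [le_nm|lt_mn] := leqP n m.
  by rewrite big_geq // ltW.
have /(_ _ (ex_intro2 _ _ n I erefl)) := sup_upper_bound supE.
rewrite (big_cat_nat (n := m)) ?(ltnW lt_mn) //= (big_cat_nat (n := N)) //=.
have : 0 <= \sum_(N <= i < m) u i by rewrite sumr_ge0.
by move: ltN; lra.
Qed.

Lemma size_congruent_leq (b T : nat) (s : seq nat) :
  (0 < b)%N -> uniq s -> {in s, forall t, (t < T)%N} ->
  {in s &, forall t u, t = u %[mod b]} -> (size s <= (T %/ b).+1)%N.
Proof.
move=> b_gt0 us sT sb; rewrite -(size_map (divn^~ b)) -[leqRHS](size_iota 0).
apply: uniq_leq_size.
  rewrite map_inj_in_uniq // => t u ts us' /= e.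
  by rewrite (divn_eq t b) (divn_eq u b) e (sb t u).
move=> _ /mapP[t ts ->]; rewrite mem_iota /= add0n ltnS.
by rewrite leq_div2r // ltnW // sT.
Qed.

Lemma dvdn_mul_gcd (b n x : nat) :
  (0 < b)%N -> (b %| n * x)%N = (b %/ gcdn b n %| x)%N.
Proof.
move=> b_gt0; have g_gt0 : (0 < gcdn b n)%N by rewrite gcdn_gt0 b_gt0.
have eb := divnK (dvdn_gcdl b n); have en := divnK (dvdn_gcdr b n).
have co : coprime (b %/ gcdn b n) (n %/ gcdn b n).
  by rewrite /coprime -(eqn_pmul2r g_gt0) muln_gcdl eb en mul1n.
move: (gcdn b n) (b %/ _)%N (n %/ _)%N g_gt0 co eb en => g b' n' g_gt0 co <- <-.
by rewrite mulnAC dvdn_pmul2r // Gauss_dvdr.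
Qed.

(** With [b' = b / gcdn b n], the condition is [b' %| t * Q + 1]. A solution forces [b'] to be
    coprime to [Q], so all solutions share one residue modulo [b']; moreover [b <= b' * n]. *)
Lemma count_dvdn_progression (n Q b T : nat) :
  (0 < n)%N -> (0 < b)%N ->
  (count (fun t => b %| n * (t * Q).+1)%N (iota 0 T) * b <= T * n + b)%N.
Proof.
move=> n_gt0 b_gt0; set g := gcdn b n; set b' := (b %/ g)%N.
have g_gt0 : (0 < g)%N by rewrite gcdn_gt0 b_gt0.
have b'g : (b' * g)%N = b by rewrite divnK ?dvdn_gcdl.
have b'_gt0 : (0 < b')%N by rewrite divn_gt0 // dvdn_leq ?dvdn_gcdl.
have sz : (count (fun t => b %| n * (t * Q).+1)%N (iota 0 T) <= (T %/ b').+1)%N.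
  rewrite -size_filter; apply: size_congruent_leq => //.
  - by rewrite filter_uniq ?iota_uniq.
  - by move=> t; rewrite mem_filter mem_iota => /andP[_].
  - move=> t u; rewrite !mem_filter => /andP[bt _] /andP[bu _].
    wlog le_ut : t u bt bu / (u <= t)%N.
      by move=> W; case: (leqP u t) => [|/ltnW] le; [|symmetry]; apply: W.
    move: bt bu; rewrite !dvdn_mul_gcd // -/g -/b' => bt bu.
    have co : coprime b' Q.
      apply: coprime_dvdl bt _.
      by rewrite coprime_sym /coprime -addn1 gcdnMDl gcdn1.
    apply/eqP; rewrite eqn_mod_dvd // -(Gauss_dvdl _ co) mulnBl.
    by rewrite -subSS dvdn_sub.
apply: leq_trans (leq_mul sz (leqnn b)) _.
rewrite mulSn addnC leq_add2r -{1}b'g mulnA leq_mul ?leq_trunc_div //.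
by rewrite dvdn_leq ?dvdn_gcdr.
Qed.

Lemma count_exists_leq (T : Type) (n : nat) (P : nat -> pred T) (s : seq T) :
  (count (fun t => [exists i : 'I_n, P i t]) s <= \sum_(0 <= i < n) count (P i) s)%N.
Proof.
rewrite big_mkord; elim: s => [|t s IHs] //=; rewrite big_split /=.
apply: leq_add => //; case: existsP => // -[i Pit].
by rewrite (bigD1 i) //= Pit.
Qed.

Section LowerDensity.
Variable R : realType.
Implicit Types (S : set nat) (x c : R).

Lemma size_leq_counting_upto S x (s : seq nat) :
  uniq s -> {in s, forall n, [/\ S n, (1 <= n)%N & n%:R <= x]} ->
  (size s <= counting_upto S x)%N.
Proof.
move=> us sS; rewrite /counting_upto.
set A := _ `&` _.
have finA : finite_set A.
  apply: (@sub_finite_set _ _ `I_(Num.trunc x).+1); last exact: finite_II.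
  move=> n [_ [_ nx]] /=; have x0 : 0 <= x by apply: le_trans (ler0n _ n) nx.
  have /andP[_] := truncn_itv x0; rewrite -(ltr_nat R).
  exact: le_lt_trans.
apply: uniq_leq_size => // n ns; rewrite in_fset_set // inE.
by have [? ? ?] := sS _ ns.
Qed.

Lemma lower_density_gt0 S c x0 :
  0 < c -> (forall x, x0 < x -> c * x <= (counting_upto S x)%:R) ->
  (0 < lower_density R S)%E.
Proof.
move=> c0 Sc; apply: (@lt_le_trans _ _ c%:E); first by rewrite lte_fin.
rewrite /lower_density limf_einfE; apply: ereal_sup_ge.
exists (ereal_inf [set ((counting_upto S x)%:R / x)%:E
                     | x in [set x | Num.max x0 0 < x]]).
  by exists [set x | Num.max x0 0 < x] => //; exists (Num.max x0 0); rewrite num_real.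
apply/ereal_infP => _ [x /= + <-]; rewrite gt_max => /andP[x0x x_gt0].
by rewrite lee_fin ler_pdivlMr // Sc.
Qed.

Lemma lower_density_set0_le0 : (lower_density R set0 <= 0)%E.
Proof.
rewrite /lower_density limf_einfE; apply: ge_ereal_sup => _ [V [M [_ MV]] <-].
apply: ge_ereal_inf; exists 0%E => //.
exists (M + 1); first by apply: MV; rewrite ltrDl.
by rewrite /counting_upto set0I fset_set0 cardfs0 mul0r.
Qed.

End LowerDensity.

(** A value [b i = 0] imposes no condition, and its inverse is 0. The bound [i <= b i] leaves
    finitely many indices to check for the multiples of [n0] up to a given size. *)
Lemma lower_density_non_multiples (R : realType) (b : nat -> nat) (M : R)
    (n0 : nat) (S : set nat) :
  (0 < n0)%N -> (forall i, ~~ (b i %| n0)%N) ->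
  (forall i, (0 < b i)%N -> (i <= b i)%N) ->
  (forall N, \sum_(0 <= i < N) ((b i)%:R : R)^-1 <= M) ->
  (forall m, (0 < m)%N -> (forall i, ~~ (b i %| n0 * m)%N) -> S (n0 * m)%N) ->
  (0 < lower_density R S)%E.
Proof.
move=> n0_gt0 bn0 ib bM Sb.
have n0R : 0 < n0%:R :> R by rewrite ltr0n.
have invb_ge0 i : 0 <= ((b i)%:R : R)^-1 by rewrite invr_ge0.
have [N1 tail1] : exists N, forall m n, (N <= m)%N ->
    \sum_(m <= i < n) ((b i)%:R : R)^-1 <= (8 * n0%:R)^-1.
  by apply: bounded_sum_tail bM _ => //; rewrite invr_gt0 mulr_gt0.
pose Q := (\prod_(i < N1) if b i == 0 then 1 else b i)%N.
have Q_gt0 : (0 < Q)%N.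
  by rewrite prodn_gt0 // => i; case: eqP => // /eqP; rewrite lt0n.
have bQ i : (i < N1)%N -> (0 < b i)%N -> (b i %| Q)%N.
  move=> iN1 bi; rewrite /Q (bigD1 (Ordinal iN1)) //= -(negbK (b i == 0%N)).
  by rewrite -lt0n bi /= dvdn_mulr.
(* A second threshold, chosen after [Q]: from [N1 + N2] on, the error term 1 in each count must be
   summed as well, which costs a factor of order [Q]. *)
have [N2 tail2] : exists N, forall m n, (N <= m)%N ->
    \sum_(m <= i < n) ((b i)%:R : R)^-1 <= (8 * n0%:R * Q.+1%:R)^-1.
  by apply: bounded_sum_tail bM _ => //; rewrite invr_gt0 !mulr_gt0.
pose elt t := (n0 * (t * Q).+1)%N.
have elt_gt0 t : (0 < elt t)%N by rewrite muln_gt0 n0_gt0.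
have elt_leq t T : (t < T)%N -> (elt t <= n0 * (T * Q).+1)%N.
  by move=> tT; rewrite leq_mul2l ltnS leq_mul2r (ltnW tT) !orbT.
pose cnt T i := count (fun t => b i %| elt t)%N (iota 0 T).
have cnt0 T i : (forall t, (t < T)%N -> ~~ (b i %| elt t)%N) -> cnt T i = 0%N.
  move=> nb; apply/eqP; rewrite -leqn0 leqNgt -has_count; apply/hasP => -[t].
  by rewrite mem_iota => /nb/negPf ->.
have nb0 i t : b i = 0%N -> ~~ (b i %| elt t)%N.
  by move=> ->; rewrite dvd0n -lt0n.
have cnt_lt T i : (i < N1)%N -> cnt T i = 0%N.
  move=> iN1; apply: cnt0 => t _; have [/nb0//|bi] := posnP (b i).
  rewrite /elt mulnS dvdn_addl ?(negPf (bn0 i)) //.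
  by rewrite dvdn_mull // dvdn_mull // bQ.
have cnt_le T i : (cnt T i)%:R <= (T * n0)%:R * ((b i)%:R)^-1 + 1 :> R.
  have [b0|bi] := posnP (b i).
    by rewrite cnt0 => [|t _]; [rewrite addr_ge0 ?mulr_ge0 | exact: nb0].
  have biR : 0 < (b i)%:R :> R by rewrite ltr0n.
  rewrite -(ler_pM2r biR) mulrDl mulfVK ?lt0r_neq0 // mul1r -!natrM -natrD ler_nat.
  exact: count_dvdn_progression.
(* The count vanishes unless [b i] is at most the largest element considered, and then the additive
   1 is at most that element divided by [b i]. *)
have cnt_ge T i :
    (cnt T i)%:R <= (T * n0 + n0 * (T * Q).+1)%:R * ((b i)%:R)^-1 :> R.
  have [b0|bi] := posnP (b i).
    by rewrite cnt0 => [|t _]; [rewrite mulr_ge0 | exact: nb0].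
  have [bi_le|bi_gt] := leqP (b i) (n0 * (T * Q).+1).
    apply: le_trans (cnt_le T i) _; rewrite natrD mulrDl lerD2l.
    by rewrite ler_pdivlMr ?ltr0n // mul1r ler_nat.
  rewrite cnt0 => [|t tT]; first by rewrite mulr_ge0.
  apply/negP => /(dvdn_leq (elt_gt0 t)); apply/negP; rewrite -ltnNge.
  exact: leq_ltn_trans (elt_leq _ _ tT) bi_gt.
pose bad T := count (fun t => [exists i : 'I_(n0 * (T * Q).+1).+1, b i %| elt t])%N
   (iota 0 T).
(* Indices below [N1] contribute nothing, those from [N1] to [N1 + N2] at most [T / 8] plus one
   each, and the rest at most [T / 8 + 1]. *)
have bad_le T : (bad T)%:R <= T%:R / 4 + (N1 + N2)%:R + 1 :> R.
  pose I := (n0 * (T * Q).+1).+1; pose J := (N1 + N2 + I)%N.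
  have : (bad T <= \sum_(0 <= i < J) cnt T i)%N.
    apply: leq_trans (@count_exists_leq _ I (fun i t => b i %| elt t)%N _) _.
    by rewrite [leqRHS](big_cat_nat (n := I)) ?leq_addl //= leq_addr.
  have le_N1J : (N1 <= J)%N by rewrite /J -addnA leq_addr.
  rewrite (big_cat_nat (n := N1)) //=.
  rewrite [X in (_ + X)%N](big_cat_nat (n := N1 + N2)) ?leq_addr //=.
  have -> : (\sum_(0 <= i < N1) cnt T i = 0)%N.
    by rewrite big_nat big1 // => i /andP[_ iN]; exact: cnt_lt.
  rewrite add0n.
  rewrite -(ler_nat R) natrD !natr_sum => /le_trans; apply.
  have -> : T%:R / 4 + (N1 + N2)%:R + 1 =
     (T%:R / 8 + (N1 + N2)%:R) + (T%:R / 8 + 1) :> R by field.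
  apply: lerD.
    apply: (@le_trans _ _ (\sum_(N1 <= i < N1 + N2) ((T * n0)%:R * ((b i)%:R)^-1 + 1))).
      by apply: ler_sum => i _; exact: cnt_le.
    rewrite big_split /= -mulr_sumr sumr_const_nat addKn lerD //; last first.
      by rewrite ler_nat leq_addl.
    apply: le_trans (ler_wpM2l (ler0n _ _) (tail1 _ _ (leqnn _))) _.
    by rewrite le_eqVlt; apply/orP; left; apply/eqP; rewrite natrM; field; rewrite lt0r_neq0.
  apply: (@le_trans _ _ (\sum_(N1 + N2 <= i < J)
            (T * n0 + n0 * (T * Q).+1)%:R * ((b i)%:R)^-1)).
    by apply: ler_sum => i _; exact: cnt_ge.
  rewrite -mulr_sumr.
  apply: le_trans (ler_wpM2l (ler0n _ _) (tail2 _ _ (leq_addl _ _))) _.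
  rewrite ler_pdivrMr ?mulr_gt0 ?ltr0n //.
  have -> : (T%:R / 8 + 1) * (8 * n0%:R * Q.+1%:R) = ((T + 8) * n0 * Q.+1)%:R :> R.
    by rewrite !natrM natrD; field.
  rewrite ler_nat; nia.
pose K : R := (n0 * Q.+1)%:R.
have K_gt0 : 0 < K by rewrite ltr0n muln_gt0 n0_gt0.
(* For [T] the integer part of [x / K], the elements with [t < T] are at most [x]. At least
   [3 * T / 4 - (N1 + N2) - 1] of them survive, which exceeds [x / (4 * K)] for [x] this large. *)
have bound x : 2 * K * (N1 + N2 + 3)%:R < x -> (4 * K)^-1 * x <= (counting_upto S x)%:R.
  move=> Kx; pose T := Num.trunc (x / K).
  have x_gt0 : 0 < x by apply: le_lt_trans Kx; rewrite !mulr_ge0 // ltW.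
  have /andP[Tx xT] : T%:R <= x / K < T.+1%:R by apply: truncn_itv; rewrite divr_ge0 // ltW.
  pose good t := ~~ [exists i : 'I_(n0 * (T * Q).+1).+1, b i %| elt t]%N.
  pose s := [seq elt t | t <- iota 0 T & good t].
  have sz : (size s + bad T = T)%N.
    by rewrite size_map size_filter addnC /bad count_predC size_iota.
  have le_s : (size s <= counting_upto S x)%N.
    apply: size_leq_counting_upto.
      rewrite map_inj_uniq ?filter_uniq ?iota_uniq // => t u.
      by move/eqP; rewrite eqn_pmul2l // eqSS eqn_pmul2r // => /eqP.
    move=> _ /mapP[t + ->]; rewrite mem_filter mem_iota /= add0n => /andP[gt tT].
    split; [|by rewrite muln_gt0 n0_gt0|].
      apply: Sb => // i; apply/negP => bi; case/existsP: gt.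
      have lei : (i < (n0 * (T * Q).+1).+1)%N.
        rewrite ltnS; apply: leq_trans (elt_leq _ _ tT); apply: leq_trans (dvdn_leq (elt_gt0 t) bi).
        by apply: ib; exact: dvdn_gt0 (elt_gt0 t) bi.
      by exists (Ordinal lei).
    have : (n0 * (t * Q).+1 <= T * (n0 * Q.+1))%N by nia.
    rewrite -(ler_nat R) [leRHS]natrM => /le_trans; apply.
    by rewrite -ler_pdivlMr.
  apply: (@le_trans _ _ (size s)%:R); last by rewrite ler_nat.
  have -> : (size s)%:R = T%:R - (bad T)%:R :> R by apply/eqP; rewrite eq_sym subr_eq -natrD sz.
  have := bad_le T.
  have -> : (4 * K)^-1 * x = x / K / 4 by rewrite invfM mulrC mulrCA mulrC.
  have : 2 * (N1 + N2 + 3)%:R < x / K by rewrite ltr_pdivlMr //; move: Kx; lra.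
  move: xT; rewrite -[T.+1%:R]natr1 (natrD _ (N1 + N2) 3).
  move: (x / K) (N1 + N2)%:R T%:R (bad T)%:R => y n u v; lra.
by apply: lower_density_gt0 bound; rewrite invr_gt0 mulr_gt0.
Qed.

(** * The numbers [lcmn p (z p)] and common divisors along the orbit *)

Section RankOfApparition.
Variables (R : realType) (F : {poly int}) (z : nat -> nat).
Hypothesis zP : forall m n, (m %| `|orbit0 F n|)%N = (z m %| n)%N.

Lemma sum_lcm_rank_bounded : wandering0 F -> nice R F ->
  exists M : R, forall N,
    \sum_(0 <= p < N | prime p) ((lcmn p (z p))%:R : R)^-1 <= M.
Proof.
move=> wF nF; have [s s_gt0 Fs] := orbit0_growth F.
have cP n : (0 < n)%N -> (0 < `|orbit0 F n| <= 2 ^ 2 ^ (s * n))%N.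
  by move=> n_gt0; rewrite absz_gt0 orbit0_neq0 ?Fs.
have dz p : (p %| `|orbit0 F (z p)|)%N by rewrite zP.
have [M1 M1P] := nice_sum_bounded nF.
have [M2 M2P] := sum_prime_rank_bounded R s_gt0 cP dz.
exists (M1 + M2) => N; apply: le_trans (lerD (M1P N) (M2P N)).
rewrite (big_mkcond prime) [in X in X + _]big_mkcond [in X in _ + X]big_mkcond.
rewrite -big_split /=; apply: ler_sum => p _.
case: (boolP (prime p)) => /= [pp|_]; last by rewrite addr0.
have p_gt0 := prime_gt0 pp.
have ge0 (b : bool) (n : nat) : 0 <= (if b then n%:R^-1 else 0 : R).
  by case: b; rewrite ?invr_ge0.
(* If [p] divides no term of positive index, the lcm is 0 and so is its inverse. *)
have [z0|z_gt0] := posnP (z p); first by rewrite z0 lcmn0 invr0 addr0 ge0.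
have [pz|npz] := boolP (p %| z p)%N.
  have ezp : z p = p.
    by apply/eqP; rewrite eqn_leq (orbit0_rank_leq zP p_gt0) dvdn_leq.
  by rewrite zP ezp dvdnn /lcmn gcdnn mulnK // lerDl invr_ge0 ler0n.
rewrite (_ : lcmn p (z p) = p * z p)%N ?lerDr ?ge0 //.
by rewrite -muln_lcm_gcd (eqP (_ : coprime p (z p))) ?muln1 // prime_coprime.
Qed.

Lemma dvdn_gcd_orbit0 (m n : nat) :
  (m %| gcdn n `|orbit0 F n|)%N = (lcmn m (z m) %| n)%N.
Proof. by rewrite dvdn_gcd dvdn_lcm zP. Qed.

(* [e p = 0] drops the condition at [p], as [0] divides no positive integer. *)
Lemma lower_density_gcd_orbit0 (e : nat -> nat) (n0 : nat) (S : set nat) :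
  wandering0 F -> nice R F -> (0 < n0)%N ->
  (forall p, prime p -> (p %| e p)%N) ->
  (forall p, prime p -> ~~ (e p %| gcdn n0 `|orbit0 F n0|)%N) ->
  (forall m, (0 < m)%N ->
     (forall p, prime p -> ~~ (e p %| gcdn (n0 * m) `|orbit0 F (n0 * m)|)%N) ->
     S (n0 * m)%N) ->
  (0 < lower_density R S)%E.
Proof.
move=> wF nF n0_gt0 pe en0 Se.
have [M MP] := sum_lcm_rank_bounded wF nF.
pose b p := if prime p then lcmn (e p) (z (e p)) else 0%N.
(* As [p] divides [e p], the rank of [p] divides that of [e p]. So a nonzero [b p] is at least
   [lcmn p (z p)], and summability carries over. *)
have pb p : prime p -> (lcmn p (z p) %| b p)%N.
  move=> pp; rewrite /b pp dvdn_lcm (dvdn_trans (pe p pp)) ?dvdn_lcml //=.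
  by apply: dvdn_trans (dvdn_lcmr _ _); rewrite -zP (dvdn_trans (pe p pp)) ?zP.
apply: (@lower_density_non_multiples R b M n0) => //.
- move=> p; rewrite /b; case: ifP => [pp|_]; last by rewrite dvd0n -lt0n.
  by rewrite -dvdn_gcd_orbit0 en0.
- move=> p bp; have pp : prime p by move: bp; rewrite /b; case: ifP.
  by apply: dvdn_leq => //; apply: dvdn_trans (pb p pp); exact: dvdn_lcml.
- move=> N; apply: le_trans (MP N); rewrite [leRHS]big_mkcond; apply: ler_sum => p _.
  case: ifP => [pp|npp]; last by rewrite /b npp invr0.
  have [->|bp] := posnP (b p); first by rewrite invr0 invr_ge0.
  have le_b := dvdn_leq bp (pb p pp).
  rewrite lef_pV2 ?posrE ?ltr0n ?ler_nat //.
  exact: dvdn_gt0 bp (pb p pp).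
- move=> m m_gt0 bm; apply: Se => // p pp.
  by rewrite dvdn_gcd_orbit0; have := bm p; rewrite /b pp.
Qed.

Lemma dvdn_gcd_orbit0_mul (d n m : nat) :
  (d %| gcdn n `|orbit0 F n|)%N ->
  (d %| gcdn (n * m) `|orbit0 F (n * m)|)%N.
Proof. by rewrite !dvdn_gcd_orbit0; exact: dvdn_mulr. Qed.

End RankOfApparition.

(** * The two equivalences *)

Lemma gcd_orbitX (F : {poly int}) (n : nat) :
  gcd_orbit F 'X n = (gcdn n `|orbit0 F n|)%:Z.
Proof. by rewrite /gcd_orbit hornerX. Qed.

Lemma lower_density_gt0_nonempty (R : realType) (S : set nat) :
  (0 < lower_density R S)%E -> S !=set0.
Proof.
move=> dS; apply/set0P/eqP => S0; move: dS.
by rewrite S0 ltNge lower_density_set0_le0.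
Qed.

Theorem theorem1p1 (R : realType) (F : {poly int}) (k : nat)
    (degF : (2 <= (size F).-1)%N) (leadF : 0 < lead_coef F)
    (wandF : wandering0 F) (niceF : nice R F) (k_gt0 : (0 < k)%N) :
  ((0 < lower_density R (B_set F 'X k))%E <-> B_set F 'X k !=set0) /\
  (nicer R F ->
   ((0 < lower_density R (A_set F 'X k))%E <-> A_set F 'X k !=set0)).
Proof.
have [z zP] := orbit0_rank F.
split=> [|_]; split; try exact: lower_density_gt0_nonempty.
- move=> [n0 [n0_gt0]]; rewrite gcd_orbitX dvdzE /= => kn0 pn0.
  (* Only primes not dividing [k] are forbidden in the gcd; divisibility by [k] itself survives
     multiplication of the index. *)
  apply: (@lower_density_gcd_orbit0 R F z zP
    (fun p => if p %| k then 0 else p)%N n0 _ wandF niceF n0_gt0).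
  + by move=> p _; case: ifP.
  + move=> p pp; case: ifP => [_|npk]; first by rewrite dvd0n -lt0n gcdn_gt0 n0_gt0.
    by apply/negP => pg; rewrite pn0 ?dvdzE in npk.
  + move=> m m_gt0 nm; split; rewrite ?muln_gt0 ?n0_gt0 // ?gcd_orbitX ?dvdzE /=.
      exact: (dvdn_gcd_orbit0_mul zP).
    move=> p pp; rewrite dvdzE /= => pg; apply: contraT => npk.
    by have := nm p pp; rewrite (negPf npk) pg.
- move=> [n0 [n0_gt0]]; rewrite gcd_orbitX => -[gk].
  (* Since [k] still divides the gcd at [n0 * m], the gcd equals [k] as soon as no [p * k] divides
     it: a prime factor of the quotient would give such a [p]. *)
  apply: (@lower_density_gcd_orbit0 R F z zP
    (fun p => p * k)%N n0 _ wandF niceF n0_gt0).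
  + by move=> p _; exact: dvdn_mulr.
  + move=> p pp; rewrite gk; apply/negP => /(dvdn_leq k_gt0).
    by rewrite leqNgt ltn_Pmull ?prime_gt1.
  + move=> m m_gt0 nm; split; first by rewrite muln_gt0 n0_gt0.
    rewrite gcd_orbitX; congr Posz.
    have kg : (k %| gcdn (n0 * m) `|orbit0 F (n0 * m)|)%N.
      by apply: (dvdn_gcd_orbit0_mul zP); rewrite gk.
    rewrite -(divnK kg); set q := (_ %/ k)%N.
    have q_gt0 : (0 < q)%N by rewrite divn_gt0 // dvdn_leq // gcdn_gt0 muln_gt0 n0_gt0 m_gt0.
    have [q_gt1|] := ltnP 1 q; last by case: (q) q_gt0 => [|[]] //; rewrite mul1n.
    have := nm _ (pdiv_prime q_gt1).
    by rewrite -(divnK kg) dvdn_pmul2r // pdiv_dvd.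
Qed.
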